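(* Let $k$ be a field, let $P=\{(0,0),(1,0),(0,1),(1,1)\}$ be the square poset with the product order, and let $A=kP$ be its incidence algebra. Let $S_{(0,0)}$ and $S_{(1,1)}$ be the simple $P$-persistence modules supported at the source $(0,0)$ and the sink $(1,1)$ respectively, and let $M=S_{(0,0)}\oplus S_{(1,1)}$. Then $$\mathrm{Ext}^2_A(M,M)\cong k.$$ In particular, $M$ carries a genuine obstruction class: it admits infinitesimal deformations that cannot be integrated into a smooth family of persistence modules.
   Context: For a poset $P$, viewed as a small category with a unique morphism $p\to q$ whenever $p\le q$, a $P$-persistence module is a functor $P\to\mathbf{Vec}_k$ to the category of $k$-vector spaces. For finite $P$, the incidence algebra $kP$ has basis $\{e_{p,q}\mid p\le q\}$ with $e_{p,q}e_{r,s}=e_{p,s}$ if $q=r$ and $0$ otherwise; finite-dimensional $A$-modules are identified with $P$-persistence modules, and $\mathrm{Ext}^i_A$ is computed in this category. The simple module supported at $v\in P$ takes the value $k$ at $v$ and $0$ at every other vertex. Deformations: for a local Artinian $k$-algebra $R$ with residue field $k$, a deformation of $M$ over $R$ is an $A\otimes_k R$-module $\tilde M$ with $\tilde M\otimes_R k\cong M$; a formal deformation of $M$ is an $A[[t]]$-module $\tilde M$ with $\tilde M/t\tilde M\cong M$. Infinitesimal (first-order) deformations of $M$ are identified with elements of $\mathrm{Ext}^1_A(M,M)$, and obstructions to lifting (extending) deformations lie in $\mathrm{Ext}^2_A(M,M)$, whose elements are called obstruction classes.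
   Formalization: The claim that M admits infinitesimal deformations that cannot be integrated is false, since Ext^1_A(M,M)=0 makes the only infinitesimal deformation trivial; it is replaced by the existence of a nonzero class in Ext^2_A(M,M). *)

(* Defs.v *)
From HB Require Import structures.
From mathcomp Require Import all_boot all_order all_algebra.
From mathcomp Require Import generic_quotient ring_quotient boolp.

Set Implicit Arguments.
Unset Strict Implicit.
Unset Printing Implicit Defensive.

Import Order.TTheory GRing.Theory.
Local Open Scope quotient_scope.
Local Open Scope ring_scope.

(* The quotient of a k-vector space by a subspace: the library's quotient     *)
(* zmodType [Quotient.quot], with its vector space structure added.           *)
Section LmodQuotient.
Variables (k : fieldType) (V : lmodType k) (I : submodClosed V).

Definition lquot_pred : {pred V} := I.

Fact lquot_zmod_closed : zmod_closed lquot_pred.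
Proof.
split=> [|x y xI yI]; first exact: (rpred0 I).
change (x - y \in I); rewrite -scaleN1r.
by apply: rpredD xI _; apply: rpredZ yI.
Qed.
HB.instance Definition _ :=
  GRing.isZmodClosed.Build V lquot_pred lquot_zmod_closed.

Definition lquot : Type := Quotient.quot lquot_pred.
HB.instance Definition _ := GRing.Zmodule.on lquot.

Definition lquot_pi (x : V) : lquot := \pi_(Quotient.quot lquot_pred) x.

Lemma lquot_piP (x y : V) : reflect (lquot_pi x = lquot_pi y) (x - y \in I).
Proof.
change (x - y \in I) with (x - y \in lquot_pred).
by rewrite Quotient.idealrBE; exact: eqP.
Qed.

Lemma lquot_piD : {morph lquot_pi : x y / x + y}.
Proof. by move=> x y; exact: (raddfD \pi_(Quotient.quot lquot_pred)). Qed.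

Lemma lquot_reprK (u : lquot) :
  lquot_pi (repr (u : Quotient.quot lquot_pred)) = u.
Proof. exact: (@reprK _ (Quotient.quot lquot_pred)). Qed.

Definition lquot_scale (a : k) (u : lquot) : lquot :=
  lquot_pi (a *: repr (u : Quotient.quot lquot_pred)).

Lemma lquot_piZ a x : lquot_pi (a *: x) = lquot_scale a (lquot_pi x).
Proof.
apply/lquot_piP; rewrite -scalerBr rpredZ //.
by apply/lquot_piP; rewrite lquot_reprK.
Qed.

Fact lquot_scalerA a b u :
  lquot_scale a (lquot_scale b u) = lquot_scale (a * b) u.
Proof. by rewrite -(lquot_reprK u) -!lquot_piZ scalerA. Qed.
Fact lquot_scale1r : left_id 1 lquot_scale.
Proof. by move=> u; rewrite -(lquot_reprK u) -!lquot_piZ scale1r. Qed.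
Fact lquot_scalerDr : right_distributive lquot_scale +%R.
Proof.
move=> a u v; rewrite -(lquot_reprK u) -(lquot_reprK v).
by rewrite -lquot_piD -!lquot_piZ scalerDr lquot_piD.
Qed.
Fact lquot_scalerDl u : {morph lquot_scale^~ u : a b / a + b}.
Proof.
by move=> a b; rewrite -(lquot_reprK u) -!lquot_piZ scalerDl lquot_piD.
Qed.

HB.instance Definition _ := GRing.Zmodule_isLmodule.Build k lquot
  lquot_scalerA lquot_scale1r lquot_scalerDr lquot_scalerDl.

End LmodQuotient.

(* Functors from the poset category P to finite-dimensional k-vector spaces;  *)
(* for finite P these are the finite-dimensional modules over the incidence   *)
(* algebra kP, e_(p,q) acting from the right as the structure map M_p -> M_q. *)
Record pmodule (k : fieldType) (d : Order.disp_t) (P : finPOrderType d) :=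
  PModule {
    pm_obj :> P -> vectType k;
    pm_map : forall p q : P, (p <= q)%O -> 'Hom(pm_obj p, pm_obj q);
    pm_map_id : forall (p : P) (pp : (p <= p)%O), pm_map pp = \1%VF;
    pm_map_comp : forall (p q r : P)
      (pq : (p <= q)%O) (qr : (q <= r)%O) (pr : (p <= r)%O),
      pm_map pr = (pm_map qr \o pm_map pq)%VF
  }.

Section Hom.
Context {k : fieldType} {d : Order.disp_t} {P : finPOrderType d}.

Record phom (M N : pmodule k P) := PHom {
  ph_val :> forall p : P, 'Hom(M p, N p);
  ph_nat : forall (p q : P) (pq : (p <= q)%O),
    (ph_val q \o pm_map M pq = pm_map N pq \o ph_val p)%VF
}.

Section Lmodule.
Variables M N : pmodule k P.
Implicit Types f g : phom M N.

HB.instance Definition _ := gen_eqMixin (phom M N).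
HB.instance Definition _ := gen_choiceMixin (phom M N).

Lemma phomP f g : (forall p, f p = g p) -> f = g.
Proof.
case: f g => [f fN] [g gN] /= fg.
have efg : f = g by apply: functional_extensionality_dep.
by case: g / efg gN {fg} => gN; congr PHom; exact: Prop_irrelevance.
Qed.

Fact phom_zero_nat p q (pq : (p <= q)%O) :
  ((0 : 'Hom(M q, N q)) \o pm_map M pq = pm_map N pq \o (0 : 'Hom(M p, N p)))%VF.
Proof. by rewrite comp_lfun0l comp_lfun0r. Qed.
Definition phom_zero : phom M N := PHom phom_zero_nat.

Fact phom_opp_nat f p q (pq : (p <= q)%O) :
  ((- f q) \o pm_map M pq = pm_map N pq \o (- f p))%VF.
Proof. by rewrite comp_lfunNl comp_lfunNr ph_nat. Qed.
Definition phom_opp f : phom M N := PHom (phom_opp_nat f).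

Fact phom_add_nat f g p q (pq : (p <= q)%O) :
  ((f q + g q)%R \o pm_map M pq = pm_map N pq \o (f p + g p)%R)%VF.
Proof. by rewrite comp_lfunDl comp_lfunDr !ph_nat. Qed.
Definition phom_add f g : phom M N := PHom (phom_add_nat f g).

Fact phom_scale_nat a f p q (pq : (p <= q)%O) :
  ((a *: f q) \o pm_map M pq = pm_map N pq \o (a *: f p))%VF.
Proof. by rewrite -comp_lfunZl -comp_lfunZr ph_nat. Qed.
Definition phom_scale a f : phom M N := PHom (phom_scale_nat a f).

Fact phom_addA : associative phom_add.
Proof. by move=> f g h; apply: phomP => p /=; rewrite addrA. Qed.
Fact phom_addC : commutative phom_add.
Proof. by move=> f g; apply: phomP => p /=; rewrite addrC. Qed.
Fact phom_add0 : left_id phom_zero phom_add.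
Proof. by move=> f; apply: phomP => p /=; rewrite add0r. Qed.
Fact phom_addN : left_inverse phom_zero phom_opp phom_add.
Proof. by move=> f; apply: phomP => p /=; rewrite addNr. Qed.
HB.instance Definition _ := GRing.isZmodule.Build (phom M N)
  phom_addA phom_addC phom_add0 phom_addN.

Fact phom_scalerA a b f :
  phom_scale a (phom_scale b f) = phom_scale (a * b) f.
Proof. by apply: phomP => p /=; rewrite scalerA. Qed.
Fact phom_scale1r : left_id 1 phom_scale.
Proof. by move=> f; apply: phomP => p /=; rewrite scale1r. Qed.
Fact phom_scalerDr : right_distributive phom_scale +%R.
Proof. by move=> a f g; apply: phomP => p /=; rewrite scalerDr. Qed.
Fact phom_scalerDl f : {morph phom_scale^~ f : a b / a + b}.
Proof. by move=> a b; apply: phomP => p /=; rewrite scalerDl. Qed.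
HB.instance Definition _ := GRing.Zmodule_isLmodule.Build k (phom M N)
  phom_scalerA phom_scale1r phom_scalerDr phom_scalerDl.

End Lmodule.

Fact pcomp_nat (L M N : pmodule k P) (g : phom M N) (f : phom L M)
    p q (pq : (p <= q)%O) :
  ((g q \o f q) \o pm_map L pq = pm_map N pq \o (g p \o f p))%VF.
Proof. by rewrite -comp_lfunA ph_nat comp_lfunA ph_nat comp_lfunA. Qed.
Definition pcomp (L M N : pmodule k P) (g : phom M N) (f : phom L M) :
  phom L N := PHom (pcomp_nat g f).

Fact pcomp_is_linear (L M N : pmodule k P) (f : phom L M) :
  linear (fun g : phom M N => pcomp g f).
Proof.
by move=> a g h; apply: phomP => p /=; rewrite comp_lfunDl -comp_lfunZl.
Qed.

(* In this category the epimorphisms are the pointwise surjections, and       *)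
(* kernels and images are computed pointwise.                                 *)
Definition pepi (M N : pmodule k P) (f : phom M N) : Prop :=
  forall p, limg (f p) = fullv.

Definition pexact (L M N : pmodule k P) (f : phom L M) (g : phom M N) : Prop :=
  forall p, limg (f p) = lker (g p).

Definition projective (Q : pmodule k P) : Prop :=
  forall (M N : pmodule k P) (g : phom M N) (f : phom Q N),
    pepi g -> exists h : phom Q M, pcomp g h = f.

(* ... -> Q_2 -> Q_1 -> Q_0 -> M -> 0, with pr_diff n : Q_(n+1) -> Q_n.       *)
Record proj_resolution (M : pmodule k P) := ProjResolution {
  pr_obj :> nat -> pmodule k P;
  pr_diff : forall n, phom (pr_obj n.+1) (pr_obj n);
  pr_aug : phom (pr_obj 0) M;
  pr_proj : forall n, projective (pr_obj n);
  pr_aug_epi : pepi pr_aug;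
  pr_aug_exact : pexact (pr_diff 0) pr_aug;
  pr_diff_exact : forall n, pexact (pr_diff n.+1) (pr_diff n)
}.

(* Ext^n(M, N) := H^n(Hom(Q_*, N)) for a projective resolution Q of M.        *)
Section Ext.
Variables (M : pmodule k P) (Q : proj_resolution M) (n : nat) (N : pmodule k P).

Definition cocycle : {pred phom (Q n) N} :=
  fun f => pcomp f (pr_diff Q n) == 0.

Fact cocycle_submod : submod_closed cocycle.
Proof.
split=> [|a f g]; rewrite !unfold_in.
  by apply/eqP/phomP => p /=; rewrite comp_lfun0l.
by move=> /eqP f0 /eqP g0; rewrite pcomp_is_linear f0 g0 scaler0 addr0.
Qed.
HB.instance Definition _ :=
  GRing.isSubmodClosed.Build k (phom (Q n) N) cocycle cocycle_submod.

Record cocycles := Cocycle {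
  cocycle_val :> phom (Q n) N;
  cocycleP : cocycle_val \in cocycle
}.
HB.instance Definition _ := [isSub for cocycle_val].
HB.instance Definition _ := [Choice of cocycles by <:].
HB.instance Definition _ := [SubChoice_isSubLmodule of cocycles by <:].

End Ext.

Definition is_coboundary (M : pmodule k P) (Q : proj_resolution M) (n : nat)
    (N : pmodule k P) : phom (Q n) N -> Prop :=
  match n with
  | 0 => fun f => f = 0
  | m.+1 => fun f => exists g : phom (Q m) N, f = pcomp g (pr_diff Q m)
  end.

Section ExtQuotient.
Variables (M : pmodule k P) (Q : proj_resolution M) (n : nat) (N : pmodule k P).

Definition coboundary : {pred cocycles Q n N} :=
  fun f => `[< is_coboundary (cocycle_val f) >].

Fact coboundary_submod : submod_closed coboundary.
Proof.
have val0 : cocycle_val (0 : cocycles Q n N) = 0 by exact: (raddf0 val).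
have valP a (f g : cocycles Q n N) :
  cocycle_val (a *: f + g) = a *: cocycle_val f + cocycle_val g.
  by exact: (linearP val).
split=> [|a f g]; rewrite !unfold_in.
  apply/asboolP; rewrite val0.
  case: (n) => [|m] //; exists 0.
  by apply: phomP => p /=; rewrite comp_lfun0l.
move=> /asboolP fB /asboolP gB; apply/asboolP; rewrite valP.
move: (cocycle_val f) (cocycle_val g) fB gB; clear; case: n => /= [|m].
  by move=> f g -> ->; rewrite scaler0 addr0.
move=> f g [f' ->] [g' ->].
by exists (a *: f' + g'); rewrite pcomp_is_linear.
Qed.
HB.instance Definition _ :=
  GRing.isSubmodClosed.Build k (cocycles Q n N) coboundary coboundary_submod.

Definition Ext : lmodType k := lquot coboundary.

End ExtQuotient.

End Hom.

Section Simple.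
Variables (k : fieldType) (d : Order.disp_t) (P : finPOrderType d) (v : P).

(* k^1 = k at v and k^0 = 0 elsewhere; pid_mx 1 is the identity of k at v and *)
(* the (only possible) zero map as soon as one of the two spaces is 0.        *)
Definition simple_obj (p : P) : vectType k := 'rV[k]_(p == v).

Definition simple_map (p q : P) (_ : (p <= q)%O) :
  'Hom(simple_obj p, simple_obj q) := linfun (mulmxr (pid_mx 1)).

Fact simple_map_id (p : P) (pp : (p <= p)%O) : simple_map pp = \1%VF.
Proof.
apply/lfunP => x; rewrite !lfunE /=; move: x; rewrite /simple_obj.
case: (p == v) => x; first by rewrite pid_mx_1 mulmx1.
by rewrite !thinmx0.
Qed.

Fact simple_map_comp (p q r : P)
    (pq : (p <= q)%O) (qr : (q <= r)%O) (pr : (p <= r)%O) :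
  simple_map pr = (simple_map qr \o simple_map pq)%VF.
Proof.
apply/lfunP => x; rewrite comp_lfunE !lfunE /=; move: x; rewrite /simple_obj.
case: (eqVneq p v) => [pv|_] x; last by rewrite thinmx0 !mul0mx.
case: (eqVneq r v) => [rv|_]; last by rewrite [LHS]thinmx0 [RHS]thinmx0.
have -> : q = v by apply: le_anti; rewrite -{1}rv -pv pq qr.
by rewrite eqxx !pid_mx_1 !mulmx1.
Qed.

Definition simple : pmodule k P := PModule simple_map_id simple_map_comp.

End Simple.

Section DirectSum.
Variables (k : fieldType) (d : Order.disp_t) (P : finPOrderType d).
Variables M N : pmodule k P.

Definition dsum_obj (p : P) : vectType k := (M p * N p)%type.

Definition dsum_fun (p q : P) (pq : (p <= q)%O) (x : dsum_obj p) : dsum_obj q :=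
  (pm_map M pq x.1, pm_map N pq x.2).

Fact dsum_fun_linear p q (pq : (p <= q)%O) : linear (dsum_fun pq).
Proof. by move=> a x y; rewrite /dsum_fun /= !linearP. Qed.
HB.instance Definition _ p q (pq : (p <= q)%O) :=
  GRing.isLinear.Build k (dsum_obj p) (dsum_obj q) _ (dsum_fun pq)
    (dsum_fun_linear pq).

Definition dsum_map (p q : P) (pq : (p <= q)%O) :
  'Hom(dsum_obj p, dsum_obj q) := linfun (dsum_fun pq).

Fact dsum_map_id (p : P) (pp : (p <= p)%O) : dsum_map pp = \1%VF.
Proof.
by apply/lfunP => -[x y]; rewrite !lfunE /= /dsum_fun !pm_map_id !lfunE.
Qed.

Fact dsum_map_comp (p q r : P)
    (pq : (p <= q)%O) (qr : (q <= r)%O) (pr : (p <= r)%O) :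
  dsum_map pr = (dsum_map qr \o dsum_map pq)%VF.
Proof.
apply/lfunP => x; rewrite comp_lfunE !lfunE /= /dsum_fun /=.
by rewrite (pm_map_comp _ pq qr pr) (pm_map_comp _ pq qr pr) !comp_lfunE.
Qed.

Definition dsum : pmodule k P := PModule dsum_map_id dsum_map_comp.

End DirectSum.

(* {0,1} x {0,1} with the product order, 0 and 1 being [false] and [true].    *)
Definition square := (bool *p bool)%type.
HB.instance Definition _ := Order.FinPOrder.on square.

(* Main.v *)
(** Let P_v be the indicator module of the up-set of v.  Then
      0 -> P_11 -> P_10 + P_01 -> P_00 -> S_00 -> 0   and   P_11 = S_11
    give a projective resolution R of M with R_2 = P_11 and R_3 = 0.  By Yoneda,
    Hom(R_2, M) = M_11 = k, while Hom(R_1, M) = M_10 + M_01 = 0; hence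
    Ext^2(M, M) = k on R.  An arbitrary resolution Q is compared with R by chain
    maps F : R -> Q and G : Q -> R, inverse up to homotopy: the isomorphism
    takes the class of f : Q_2 -> M to the value of f F_2 at the generator of
    P_11. *)

From HB Require Import structures.
From mathcomp Require Import all_boot all_order all_algebra.
From mathcomp Require Import generic_quotient boolp.
Require Import Defs.

Set Implicit Arguments.
Unset Strict Implicit.
Unset Printing Implicit Defensive.

Import Order.TTheory GRing.Theory.
Local Open Scope ring_scope.

(** * Tools from choice and linear algebra *)

Lemma dependent_choice (T : nat -> Type) (E : forall n, T n -> T n.+1 -> Prop)
    (x0 : T 0) (x1 : T 1) :
    E 0 x0 x1 -> (forall n x y, E n x y -> exists z, E n.+1 y z) ->
  exists2 s : forall n, T n, s 0 = x0 & forall n, E n (s n) (s n.+1).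
Proof.
move=> E0 step.
(* [step] yields a successor of [y] only once [y] is known to be related to its predecessor, so the
   recursion runs on related pairs of consecutive terms. *)
pose S n := {xy : T n * T n.+1 | E n xy.1 xy.2}.
pose next n (u : S n) : S n.+1 :=
  let z := cid (step n _ _ (svalP u)) in exist _ ((sval u).2, sval z) (svalP z).
pose s := nat_rect S (exist _ (x0, x1) E0) next.
by exists (fun n => (sval (s n)).1) => // n; exact: (svalP (s n)).
Qed.

(** First isomorphism theorem for a functional with kernel [I]: [L] descends injectively to the
    quotient, and since [L c = 1] the inverse sends [a] to the class of [a *: c]. *)
Lemma lquot_iso_field (k : fieldType) (V : lmodType k) (I : submodClosed V)
    (L : {linear V -> k^o}) (c : V) :
    (forall x, (x \in I) = (L x == 0)) -> L c = 1 ->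
  exists phi : {linear lquot I -> k^o}, bijective phi.
Proof.
move=> IL Lc.
pose phi (u : lquot I) : k^o := L (repr (u : Quotient.quot (lquot_pred I))).
have phi_pi x : phi (lquot_pi I x) = L x.
  apply/eqP; rewrite -subr_eq0 -linearB -IL; apply/lquot_piP.
  exact: lquot_reprK.
have phi_lin : linear phi.
  move=> a u v; rewrite -(lquot_reprK u) -(lquot_reprK v).
  rewrite -[X in phi (X + _)]lquot_piZ -lquot_piD !phi_pi.
  exact: linearP.
pose phiL := GRing.isLinear.Build k (lquot I) k^o _ phi phi_lin.
exists (HB.pack_for {linear lquot I -> k^o} phi phiL).
exists (fun a => lquot_pi I (a *: c)) => [u|a] /=.
  rewrite -{2}(lquot_reprK u); apply/lquot_piP.
  rewrite IL linearB linearZ /= Lc /phi subr_eq0.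
  by apply/eqP; exact: mulr1.
by rewrite phi_pi linearZ /= Lc; exact: mulr1.
Qed.

Lemma linfun_linearE (k : fieldType) (V W : vectType k) (f : V -> W) x :
  linear f -> linfun f x = f x.
Proof.
move=> lin_f; pose fL := GRing.isLinear.Build k V W _ f lin_f.
exact: (lfunE (HB.pack_for {linear V -> W} f fL)).
Qed.

(** * Elementwise calculus of morphisms, exactness and epimorphisms *)

Section Category.
Context {k : fieldType} {d : Order.disp_t} {P : finPOrderType d}.
Implicit Types L M N : pmodule k P.

Lemma phom_ext M N (f g : phom M N) : (forall p x, f p x = g p x) -> f = g.
Proof. by move=> fg; apply: phomP => p; apply/lfunP => x. Qed.

Lemma phom_natE M N (f : phom M N) p q (pq : (p <= q)%O) x :
  f q (pm_map M pq x) = pm_map N pq (f p x).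
Proof. by rewrite -comp_lfunE ph_nat comp_lfunE. Qed.

Lemma pcompE L M N (g : phom M N) (f : phom L M) p x :
  pcomp g f p x = g p (f p x).
Proof. exact: comp_lfunE. Qed.

Lemma phomDE M N (f g : phom M N) p x : (f + g) p x = f p x + g p x.
Proof. exact: add_lfunE. Qed.

Lemma phomNE M N (f : phom M N) p x : (- f) p x = - f p x.
Proof. exact: opp_lfunE. Qed.

Lemma phom0E M N p x : (0 : phom M N) p x = 0.
Proof. exact: zero_lfunE. Qed.

Lemma phomZE M N a (f : phom M N) p x : (a *: f) p x = a *: f p x.
Proof. exact: scale_lfunE. Qed.

Definition phomE := (pcompE, phomDE, phomNE, phom0E, phomZE).

Lemma pcompA K L M N (h : phom M N) (g : phom L M) (f : phom K L) :
  pcomp h (pcomp g f) = pcomp (pcomp h g) f.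
Proof. by apply: phom_ext => p x; rewrite !phomE. Qed.

Lemma pcomp0l L M N (f : phom L M) : pcomp (0 : phom M N) f = 0.
Proof. by apply: phom_ext => p x; rewrite !phomE. Qed.

Lemma pcomp0r L M N (g : phom M N) : pcomp g (0 : phom L M) = 0.
Proof. by apply: phom_ext => p x; rewrite !phomE linear0. Qed.

Lemma pcompBl L M N (g h : phom M N) (f : phom L M) :
  pcomp (g - h) f = pcomp g f - pcomp h f.
Proof. by apply: phom_ext => p x; rewrite !phomE. Qed.

Lemma pcompDr L M N (g : phom M N) (f h : phom L M) :
  pcomp g (f + h) = pcomp g f + pcomp g h.
Proof. by apply: phom_ext => p x; rewrite !phomE linearD. Qed.

Lemma pcompBr L M N (g : phom M N) (f h : phom L M) :
  pcomp g (f - h) = pcomp g f - pcomp g h.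
Proof. by apply: phom_ext => p x; rewrite !phomE linearB. Qed.

Definition pid M : phom M M.
Proof.
exists (fun p => \1%VF) => p q pq.
by rewrite comp_lfun1l comp_lfun1r.
Defined.

Lemma pidE M p x : pid M p x = x.
Proof. exact: id_lfunE. Qed.

Lemma pcomp1l L M (f : phom L M) : pcomp (pid M) f = f.
Proof. by apply: phom_ext => p x; rewrite pcompE pidE. Qed.

Lemma pcomp1r L M (f : phom L M) : pcomp f (pid L) = f.
Proof. by apply: phom_ext => p x; rewrite pcompE pidE. Qed.

Lemma pexactP L M N (f : phom L M) (g : phom M N) :
  pexact f g <->
  pcomp g f = 0 /\ forall p y, g p y = 0 -> exists x, y = f p x.
Proof.
split=> [fg|[gf0 fg] p].
  split=> [|p y gy].
    apply: phom_ext => p x; rewrite !phomE; apply/eqP.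
    by rewrite -memv_ker -fg memv_img ?memvf.
  have /memv_imgP[x _ ->] : y \in limg (f p) by rewrite fg memv_ker gy.
  by exists x.
apply/vspaceP => y; rewrite memv_ker.
apply/memv_imgP/eqP => [[x _ ->]|/fg[x ->]].
  by rewrite -pcompE gf0 phom0E.
by exists x; rewrite ?memvf.
Qed.

Lemma pepiP M N (f : phom M N) : pepi f <-> forall p y, exists x, y = f p x.
Proof.
split=> [fe p y|fe p].
  have /memv_imgP[x _ ->] : y \in limg (f p) by rewrite fe memvf.
  by exists x.
apply/vspaceP => y; rewrite memvf; apply/memv_imgP.
by have [x ->] := fe p y; exists x; rewrite ?memvf.
Qed.

(** * Kernels and lifting from projectives *)

Section Kernel.
Variables (M N : pmodule k P) (g : phom M N).

Definition pker_obj p : vectType k := subvs_of (lker (g p)).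

(** The projection [vsproj] only changes the type: naturality of [g] keeps the image inside the
    kernel, where [vsproj] is the identity. *)
Definition pker_map p q (pq : (p <= q)%O) : 'Hom(pker_obj p, pker_obj q) :=
  (linfun (vsproj (lker (g q))) \o (pm_map M pq \o linfun vsval))%VF.

Lemma pker_mapE p q (pq : (p <= q)%O) (u : pker_obj p) :
  vsval (pker_map pq u) = pm_map M pq (vsval u).
Proof.
rewrite !comp_lfunE !lfunE /= vsprojK // memv_ker phom_natE.
have : vsval u \in lker (g p) by exact: subvsP.
by rewrite memv_ker => /eqP ->; rewrite linear0.
Qed.

Fact pker_map_id p (pp : (p <= p)%O) : pker_map pp = \1%VF.
Proof.
apply/lfunP => u; apply: subvs_inj.
by rewrite (pker_mapE pp u) pm_map_id !lfunE.
Qed.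

Fact pker_map_comp p q r (pq : (p <= q)%O) (qr : (q <= r)%O) (pr : (p <= r)%O) :
  pker_map pr = (pker_map qr \o pker_map pq)%VF.
Proof.
apply/lfunP => u; apply: subvs_inj.
rewrite [in RHS]comp_lfunE (pker_mapE pr u) (pker_mapE qr _) (pker_mapE pq u).
by rewrite (pm_map_comp _ pq qr) comp_lfunE.
Qed.

Definition pker : pmodule k P := PModule pker_map_id pker_map_comp.

Definition pker_incl : phom pker M.
Proof.
exists (fun p => linfun vsval) => p q pq.
apply/lfunP => u; rewrite [in LHS]comp_lfunE [in RHS]comp_lfunE.
rewrite lfunE [X in pm_map M pq X]lfunE; exact: pker_mapE.
Defined.

Lemma pker_inclE p u : pker_incl p u = vsval u.
Proof. by rewrite lfunE. Qed.

Lemma pker_lift L (f : phom L M) :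
  pcomp g f = 0 -> exists f' : phom L pker, pcomp pker_incl f' = f.
Proof.
move=> gf0.
have fK p x : f p x \in lker (g p) by rewrite memv_ker -pcompE gf0 phom0E.
pose f' p : 'Hom(L p, pker p) := (linfun (vsproj (lker (g p))) \o f p)%VF.
have f'E p x : vsval (f' p x) = f p x.
  by rewrite comp_lfunE lfunE; exact/vsprojK/fK.
have f'N (p q : P) (pq : (p <= q)%O) :
    (f' q \o pm_map L pq = pker_map pq \o f' p)%VF.
  apply/lfunP => x; apply: subvs_inj.
  rewrite [in LHS]comp_lfunE [in RHS]comp_lfunE f'E (pker_mapE pq (f' p x)).
  by rewrite f'E phom_natE.
exists (PHom f'N : phom L pker).
by apply: phom_ext => p x; rewrite pcompE pker_inclE f'E.
Qed.

End Kernel.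

(** By exactness the corestriction of [f] to the kernel of [g] is an epimorphism, and [h] factors
    through that kernel; projectivity of [Q] lifts the factorization. *)
Lemma projective_lift (Q L M N : pmodule k P) (f : phom L M) (g : phom M N)
    (h : phom Q M) :
    projective Q -> pexact f g -> pcomp g h = 0 ->
  exists h' : phom Q L, pcomp f h' = h.
Proof.
move=> projQ /pexactP[gf0 exfg] gh0.
have [f' f'E] := pker_lift gf0; have [h1 h1E] := pker_lift gh0.
have epi_f' : pepi f'.
  apply/pepiP => p y; have [|x xE] := exfg p (vsval y).
    by apply/eqP; rewrite -memv_ker; exact: subvsP.
  by exists x; apply: subvs_inj; rewrite xE -f'E pcompE pker_inclE.
have [h' h'E] := projQ _ _ f' h1 epi_f'.
by exists h'; rewrite -f'E -pcompA h'E.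
Qed.

(** * Comparison theorem for projective resolutions *)

Section Comparison.

Definition chain_map M (Q R : proj_resolution M)
    (F : forall n, phom (Q n) (R n)) :=
  pcomp (pr_aug R) (F 0) = pr_aug Q /\
  forall n, pcomp (pr_diff R n) (F n.+1) = pcomp (F n) (pr_diff Q n).

Variable M : pmodule k P.
Implicit Types Q R S : proj_resolution M.

Lemma pr_aug_diff Q : pcomp (pr_aug Q) (pr_diff Q 0) = 0.
Proof. by have /pexactP[] := @pr_aug_exact _ _ _ _ Q. Qed.

Lemma pr_diff_diff Q n : pcomp (pr_diff Q n) (pr_diff Q n.+1) = 0.
Proof. by have /pexactP[] := @pr_diff_exact _ _ _ _ Q n. Qed.

(** In each degree the composite of the map already built with the differential of [Q] is killed by
    the next map of [R], so it lifts. Degrees 0 and 1 are built by hand because they involve the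
    augmentations. *)
Lemma chain_map_exists Q R : exists F, @chain_map M Q R F.
Proof.
have [F0 F0E] := @pr_proj _ _ _ _ Q 0 _ _ _ (pr_aug Q) (@pr_aug_epi _ _ _ _ R).
have [|F1 F1E] := projective_lift (h := pcomp F0 (pr_diff Q 0))
    (@pr_proj _ _ _ _ Q 1) (@pr_aug_exact _ _ _ _ R).
  by rewrite pcompA F0E pr_aug_diff.
have [n x y yE|F F0' FE] := @dependent_choice (fun n => phom (Q n) (R n))
    (fun n x y => pcomp (pr_diff R n) y = pcomp x (pr_diff Q n)) _ _ F1E.
  apply: projective_lift (@pr_proj _ _ _ _ Q _) (@pr_diff_exact _ _ _ _ R n) _.
  by rewrite pcompA yE -pcompA pr_diff_diff pcomp0r.
by exists F; split; rewrite ?F0'.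
Qed.

Lemma chain_map_comp Q R S F G : @chain_map M Q R F -> @chain_map M R S G ->
  @chain_map M Q S (fun n => pcomp (G n) (F n)).
Proof.
move=> [F0 FE] [G0 GE]; split=> [|n]; first by rewrite pcompA G0.
by rewrite pcompA GE -pcompA FE pcompA.
Qed.

(** [F] and the identity both cover the identity of [M], so their difference is null-homotopic. The
    equation is stated from degree 1 on, since in degree 0 it has only one summand on the right. *)
Lemma chain_map_homotopy Q F : @chain_map M Q Q F ->
  exists h : forall n, phom (Q n) (Q n.+1), forall n,
    pid (Q n.+1) - F n.+1 =
      pcomp (pr_diff Q n.+1) (h n.+1) + pcomp (h n) (pr_diff Q n).
Proof.
move=> [F0 FE].
have [|h0 h0E] := projective_lift (h := pid (Q 0) - F 0)
    (@pr_proj _ _ _ _ Q 0) (@pr_aug_exact _ _ _ _ Q).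
  by rewrite pcompBr pcomp1r F0 subrr.
have [|h1 h1E] := projective_lift
    (h := pid (Q 1) - F 1 - pcomp h0 (pr_diff Q 0))
    (@pr_proj _ _ _ _ Q 1) (@pr_diff_exact _ _ _ _ Q 0).
  by rewrite !pcompBr pcompA h0E FE pcompBl pcomp1r pcomp1l subrr.
have [||h _ hE] := @dependent_choice (fun n => phom (Q n) (Q n.+1))
    (fun n x y => pid (Q n.+1) - F n.+1 =
       pcomp (pr_diff Q n.+1) y + pcomp x (pr_diff Q n)) h0 h1.
- by rewrite h1E subrK.
- move=> n x y yE.
  have [|z zE] := projective_lift
      (h := pid (Q n.+2) - F n.+2 - pcomp y (pr_diff Q n.+1))
      (@pr_proj _ _ _ _ Q _) (@pr_diff_exact _ _ _ _ Q n.+1).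
    (* The map to be lifted is killed by the differential: substitute the equation one degree below,
       then use that two consecutive differentials compose to 0. *)
    rewrite !pcompBr pcompA FE pcomp1r.
    have -> : pcomp (pr_diff Q n.+1) y =
        pid (Q n.+1) - F n.+1 - pcomp x (pr_diff Q n).
      by rewrite yE addrK.
    by rewrite !pcompBl pcomp1l -pcompA pr_diff_diff pcomp0r subr0 subrr.
  by exists z; rewrite zE subrK.
- by exists h.
Qed.

End Comparison.

(** * Biproduct structure of direct sums *)

Section DirectSums.
Variables A B : pmodule k P.

Lemma dsum_mapE p q (pq : (p <= q)%O) x :
  pm_map (dsum A B) pq x = (pm_map A pq x.1, pm_map B pq x.2).
Proof. by rewrite lfunE. Qed.

Definition pinl_fun p : 'Hom(A p, dsum A B p) := linfun (fun x => (x, 0)).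

Lemma pinl_funE p x : pinl_fun p x = (x, 0).
Proof. by apply: linfun_linearE => a y z; congr pair; rewrite /= scaler0 addr0. Qed.

Definition pinl : phom A (dsum A B).
Proof.
exists pinl_fun => p q pq; apply/lfunP => x.
by rewrite !comp_lfunE !pinl_funE dsum_mapE linear0.
Defined.

Lemma pinlE p x : pinl p x = (x, 0).
Proof. exact: pinl_funE. Qed.

Definition pinr_fun p : 'Hom(B p, dsum A B p) := linfun (fun x => (0, x)).

Lemma pinr_funE p x : pinr_fun p x = (0, x).
Proof. by apply: linfun_linearE => a y z; congr pair; rewrite /= scaler0 addr0. Qed.

Definition pinr : phom B (dsum A B).
Proof.
exists pinr_fun => p q pq; apply/lfunP => x.
by rewrite !comp_lfunE !pinr_funE dsum_mapE linear0.
Defined.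

Lemma pinrE p x : pinr p x = (0, x).
Proof. exact: pinr_funE. Qed.

Section Copair.
Variables (N : pmodule k P) (f : phom A N) (g : phom B N).

Definition pcopair_fun p : 'Hom(dsum A B p, N p) :=
  linfun (fun x => f p x.1 + g p x.2).

Lemma pcopair_funE p x : pcopair_fun p x = f p x.1 + g p x.2.
Proof.
by apply: linfun_linearE => a y z; rewrite /= !linearP scalerDr addrACA.
Qed.

Definition pcopair : phom (dsum A B) N.
Proof.
exists pcopair_fun => p q pq; apply/lfunP => x.
by rewrite !comp_lfunE !pcopair_funE dsum_mapE !phom_natE linearD.
Defined.

Lemma pcopairE p x : pcopair p x = f p x.1 + g p x.2.
Proof. exact: pcopair_funE. Qed.

End Copair.

Lemma projective_dsum : projective A -> projective B -> projective (dsum A B).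
Proof.
move=> projA projB M N g f epi_g.
have [hA hAE] := projA _ _ g (pcomp f pinl) epi_g.
have [hB hBE] := projB _ _ g (pcomp f pinr) epi_g.
exists (pcopair hA hB); apply: phom_ext => p [x y].
rewrite pcompE pcopairE linearD /= -(pcompE g hA) -(pcompE g hB) hAE hBE.
by rewrite !pcompE pinlE pinrE -linearD; congr (f p (_, _)); rewrite /= ?addr0 ?add0r.
Qed.

Lemma dsum_hom_eq0 N (f : phom (dsum A B) N) :
  pcomp f pinl = 0 -> pcomp f pinr = 0 -> f = 0.
Proof.
move=> fl0 fr0; apply: phom_ext => p [x y]; rewrite phom0E.
have -> : (x, y) = pinl p x + pinr p y.
  by rewrite pinlE pinrE; congr pair; rewrite /= ?addr0 ?add0r.
by rewrite linearD /= -(pcompE f pinl) -(pcompE f pinr) fl0 fr0 !phom0E addr0.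
Qed.

End DirectSums.
End Category.

(** * Canonical maps between the spaces k and 0 *)

Section BooleanRows.
Variable k : fieldType.

(* On rows of length at most 1, [rowsum] is the coordinate and                *)
(* [const_mx (rowsum u)] the canonical map between spaces of the form k or 0. *)
Definition rowsum n (u : 'rV[k]_n) : k := \sum_i u 0 i.

Lemma rowsum_linear n : linear (@rowsum n : 'rV[k]_n -> k^o).
Proof.
move=> a u v; rewrite /rowsum scaler_sumr -big_split.
by apply: eq_bigr => i _; rewrite !mxE.
Qed.
HB.instance Definition _ n :=
  GRing.isLinear.Build k 'rV[k]_n k^o _ (@rowsum n) (@rowsum_linear n).

Lemma rowsum0 n : rowsum (0 : 'rV_n) = 0.
Proof. exact: linear0. Qed.

Lemma rowsumD n (u v : 'rV_n) : rowsum (u + v) = rowsum u + rowsum v.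
Proof. exact: linearD. Qed.

Lemma rowsumN n (u : 'rV_n) : rowsum (- u) = - rowsum u.
Proof. exact: linearN. Qed.

Lemma rowsum_const (b : bool) a :
  rowsum (const_mx a : 'rV_b) = if b then a else 0.
Proof. by rewrite /rowsum; case: b; rewrite ?big_ord0 // big_ord1 mxE. Qed.

Lemma rowsumK (b : bool) (u : 'rV_b) : const_mx (rowsum u) = u.
Proof.
case: b u => u; last by rewrite [RHS]thinmx0 [LHS]thinmx0.
by apply/rowP => i; rewrite mxE /rowsum big_ord1 [i]ord1.
Qed.

Lemma rowsum_false (u : 'rV_false) : rowsum u = 0.
Proof. exact: big_ord0. Qed.

Lemma rowsum_inj (b : bool) : injective (@rowsum b).
Proof. exact: can_inj (@rowsumK b). Qed.

Lemma rowsum_widen (a b : bool) (u : 'rV_a) :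
  a ==> b -> rowsum (const_mx (rowsum u) : 'rV_b) = rowsum u.
Proof. by case: a u b => u [] // _; rewrite rowsum_const // rowsum_false. Qed.

Lemma const_rowsum_eq0 (a b : bool) (u : 'rV_a) :
  a ==> b -> const_mx (rowsum u) = 0 :> 'rV_b -> u = 0.
Proof.
move=> ab u0; apply: rowsum_inj.
by rewrite -(rowsum_widen u ab) u0 !rowsum0.
Qed.

Definition rowsum_hom m n : 'Hom('rV[k]_m, 'rV[k]_n) :=
  linfun (fun u => const_mx (rowsum u)).

Lemma rowsum_homE m n u : rowsum_hom m n u = const_mx (rowsum u).
Proof.
by apply: linfun_linearE => a v w; apply/rowP => i; rewrite linearP !mxE.
Qed.

Lemma rowsum_hom_id (b : bool) : rowsum_hom b b = \1%VF.
Proof. by apply/lfunP => u; rewrite rowsum_homE rowsumK id_lfunE. Qed.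

(** The only case in which passing through the middle space loses information is k -> 0 -> k, which
    the hypothesis excludes. *)
Lemma rowsum_hom_comp (a b c : bool) : a ==> c ==> b ->
  (rowsum_hom b c \o rowsum_hom a b)%VF = rowsum_hom a c.
Proof.
move=> abc; apply/lfunP => u; rewrite comp_lfunE !rowsum_homE rowsum_const.
case: a b c u abc => [] [] [] // u _; rewrite ?rowsum_false //.
by rewrite [LHS]thinmx0 [RHS]thinmx0.
Qed.

(** Brings the structure maps of [simple] into the same form as those of the principal modules. *)
Lemma pid_mx_rowsum_hom (a b : bool) (u : 'rV_a) :
  u *m pid_mx 1 = rowsum_hom a b u.
Proof.
rewrite rowsum_homE; case: b; last by rewrite [LHS]thinmx0 [RHS]thinmx0.
case: a u => u; first by rewrite pid_mx_1 mulmx1 rowsumK.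
by rewrite thinmx0 mul0mx linear0.
Qed.

End BooleanRows.

(** * Principal modules P_v and the Yoneda lemma *)

Section Principal.
Variables (k : fieldType) (d : Order.disp_t) (P : finPOrderType d).

Section Representable.
Variable v : P.

Definition principal_obj (p : P) : vectType k := 'rV[k]_(v <= p)%O.

Definition principal_map (p q : P) (_ : (p <= q)%O) :
  'Hom(principal_obj p, principal_obj q) := rowsum_hom k (v <= p)%O (v <= q)%O.

Fact principal_map_id (p : P) (pp : (p <= p)%O) : principal_map pp = \1%VF.
Proof. exact: rowsum_hom_id. Qed.

Fact principal_map_comp (p q r : P)
    (pq : (p <= q)%O) (qr : (q <= r)%O) (pr : (p <= r)%O) :
  principal_map pr = (principal_map qr \o principal_map pq)%VF.
Proof.
apply/esym/rowsum_hom_comp; apply/implyP => vp.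
by rewrite (le_trans vp pq) implybT.
Qed.

Definition principal : pmodule k P :=
  PModule principal_map_id principal_map_comp.

Definition principal_gen : principal v := const_mx 1.

Lemma principal_span p (vp : (v <= p)%O) (u : principal p) :
  u = rowsum u *: pm_map principal vp principal_gen.
Proof.
rewrite rowsum_homE rowsum_const lexx -{1}(rowsumK u).
by apply/rowP => i; rewrite !mxE mulr1.
Qed.

Lemma principal_eq0 p (u : principal p) : ~~ (v <= p)%O -> u = 0.
Proof.
rewrite -(rowsumK u); move: u; rewrite /= /principal_obj.
by case: (v <= p)%O => // u _; rewrite rowsum_false.
Qed.

(** Each element of P_v is a multiple of a translate of the generator, so naturality leaves no
    freedom beyond the image of the generator. *)
Lemma principal_hom_eq (N : pmodule k P) (f g : phom principal N) :
  f v principal_gen = g v principal_gen -> f = g.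
Proof.
move=> fg; apply: phom_ext => p u.
have [vp|vp] := boolP (v <= p)%O; last by rewrite (principal_eq0 u vp) !linear0.
have hE (h : phom principal N) :
    h p u = rowsum u *: pm_map N vp (h v principal_gen).
  by rewrite {1}(principal_span vp u) -phom_natE; exact: linearZ.
by rewrite !hE fg.
Qed.

(** The structure map of [N] takes a proof of [v <= p] as argument, so the case split must supply
    one; the value is 0 off the up-set of [v]. *)
Definition yoneda_fun (N : pmodule k P) (x : N v) (p : P) (u : principal p) :
    N p :=
  if @idP (v <= p)%O is ReflectT vp then rowsum u *: pm_map N vp x else 0.

Lemma yoneda_exists (N : pmodule k P) (x : N v) :
  exists f : phom principal N, f v principal_gen = x.
Proof.
pose f p : 'Hom(principal p, N p) := linfun (@yoneda_fun N x p).
have fE p (vp : (v <= p)%O) u : f p u = rowsum u *: pm_map N vp x.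
  rewrite linfun_linearE /yoneda_fun.
    by case: {-}_ / idP => // vp'; rewrite (bool_irrelevance vp vp').
  move=> a y z; case: {-}_ / idP => [vp'|_]; last by rewrite scaler0 addr0.
  rewrite scalerA -scalerDl; congr (_ *: _); exact: rowsum_linear.
have fN p q (pq : (p <= q)%O) :
    (f q \o pm_map principal pq = pm_map N pq \o f p)%VF.
  apply/lfunP => u; rewrite !comp_lfunE.
  have [vp|vp] := boolP (v <= p)%O; last first.
    by rewrite (principal_eq0 u vp) !linear0.
  have vq := le_trans vp pq.
  rewrite (fE q vq) (fE p vp) linearZ /= (pm_map_comp N vp pq vq) comp_lfunE.
  by rewrite rowsum_homE rowsum_const vq.
exists (PHom fN); rewrite /= (fE v (lexx v)) rowsum_const lexx scale1r.
by rewrite pm_map_id id_lfunE.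
Qed.

(** By Yoneda, lifting a morphism out of P_v amounts to lifting one element of [N v] along a
    surjection. *)
Lemma projective_principal : projective principal.
Proof.
move=> M N g f /pepiP epi_g.
have [x xE] := epi_g v (f v principal_gen).
have [h hE] := yoneda_exists x.
by exists h; apply: principal_hom_eq; rewrite pcompE hE xE.
Qed.

Fact principal_top_nat p q (pq : (p <= q)%O) :
  (rowsum_hom k (v <= q)%O (q == v) \o pm_map principal pq =
   pm_map (simple k v) pq \o rowsum_hom k (v <= p)%O (p == v))%VF.
Proof.
have -> : pm_map (simple k v) pq = rowsum_hom k (p == v) (q == v).
  by apply/lfunP => u; rewrite lfunE; exact: pid_mx_rowsum_hom.
rewrite [LHS]rowsum_hom_comp ?[RHS]rowsum_hom_comp //.
  (* From v <= p <= q = v follows p = v, so the path through the simple module does not cross 0. *)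
  apply/implyP => vp; apply/implyP => /eqP qv.
  by rewrite eq_le vp -{1}qv pq.
by apply/implyP => vp; rewrite (le_trans vp pq) implybT.
Qed.
Definition principal_top : phom principal (simple k v) :=
  @PHom k d P principal (simple k v) (fun p => rowsum_hom k (v <= p)%O (p == v))
    principal_top_nat.

Lemma principal_topE p u : principal_top p u = const_mx (rowsum u).
Proof. exact: rowsum_homE. Qed.

End Representable.

Section Inclusion.
Variables (v w : P) (wv : (w <= v)%O).

Fact principal_incl_nat p q (pq : (p <= q)%O) :
  (rowsum_hom k (v <= q)%O (w <= q)%O \o pm_map (principal v) pq =
   pm_map (principal w) pq \o rowsum_hom k (v <= p)%O (w <= p)%O)%VF.
Proof.
rewrite [LHS]rowsum_hom_comp ?[RHS]rowsum_hom_comp //; apply/implyP => vp.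
  by rewrite (le_trans wv vp) implybT.
by rewrite (le_trans vp pq) implybT.
Qed.
Definition principal_incl : phom (principal v) (principal w) :=
  @PHom k d P (principal v) (principal w)
    (fun p => rowsum_hom k (v <= p)%O (w <= p)%O) principal_incl_nat.

Lemma principal_inclE p u : principal_incl p u = const_mx (rowsum u).
Proof. exact: rowsum_homE. Qed.

End Inclusion.

Fact zero_pmodule_id (p : P) (pp : (p <= p)%O) :
  (0 : 'Hom('rV[k]_0, 'rV[k]_0)) = \1%VF.
Proof. by apply/lfunP => u; rewrite [LHS]thinmx0 [RHS]thinmx0. Qed.
Fact zero_pmodule_comp (p q r : P)
    (pq : (p <= q)%O) (qr : (q <= r)%O) (pr : (p <= r)%O) :
  0 = ((0 : 'Hom('rV[k]_0, 'rV[k]_0)) \o (0 : 'Hom('rV[k]_0, 'rV[k]_0)))%VF.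
Proof. by rewrite comp_lfun0l. Qed.
Definition zero_pmodule : pmodule k P :=
  @PModule k d P (fun=> 'rV[k]_0) (fun _ _ _ => 0)
    zero_pmodule_id zero_pmodule_comp.

Lemma zero_pmodule_eq0 p (x : zero_pmodule p) : x = 0.
Proof. exact: thinmx0. Qed.

Lemma projective_zero : projective zero_pmodule.
Proof.
move=> M N g f _; exists 0; apply: phom_ext => p x.
by rewrite (zero_pmodule_eq0 x) !linear0.
Qed.

End Principal.

(** * The explicit resolution of M over the square *)

Section SquareResolution.
Variable k : fieldType.

Local Notation v00 := ((false, false) : square).
Local Notation v10 := ((true, false) : square).
Local Notation v01 := ((false, true) : square).
Local Notation v11 := ((true, true) : square).
Local Notation M := (dsum (simple k v00) (simple k v11)).

Definition square_obj (n : nat) : pmodule k square :=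
  match n with
  | 0 => dsum (principal k v00) (principal k v11)
  | 1 => dsum (principal k v10) (principal k v01)
  | 2 => principal k v11
  | _ => zero_pmodule k square
  end.

(** [pinl] in degree 0 lands in the summand P_00 only, the summand P_11 being its own resolution.
    The sign in degree 1 makes the two paths from P_11 to P_00 cancel. *)
Definition square_diff (n : nat) : phom (square_obj n.+1) (square_obj n) :=
  match n with
  | 0 => pcomp (pinl _ _)
      (pcopair (principal_incl k (isT : v00 <= v10)%O)
               (principal_incl k (isT : v00 <= v01)%O))
  | 1 => pcomp (pinl _ _) (principal_incl k (isT : v10 <= v11)%O)
       - pcomp (pinr _ _) (principal_incl k (isT : v01 <= v11)%O)
  | _ => 0
  end.

Definition square_aug : phom (square_obj 0) M :=
  pcopair (pcomp (pinl _ _) (principal_top k v00))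
          (pcomp (pinr _ _) (principal_top k v11)).

Lemma square_diff0E p x :
  square_diff 0 p x = (const_mx (rowsum x.1) + const_mx (rowsum x.2), 0).
Proof. by rewrite pcompE pinlE pcopairE !principal_inclE. Qed.

Lemma square_diff1E p x :
  square_diff 1 p x = (const_mx (rowsum x), - const_mx (rowsum x)).
Proof.
rewrite phomDE phomNE !pcompE pinlE pinrE !principal_inclE.
by congr pair; rewrite /= ?subr0 ?sub0r.
Qed.

Lemma square_augE p x :
  square_aug p x = (const_mx (rowsum x.1), const_mx (rowsum x.2)).
Proof.
rewrite pcopairE !pcompE pinlE pinrE !principal_topE.
by congr pair; rewrite /= ?addr0 ?add0r.
Qed.

Lemma square_proj n : projective (square_obj n).
Proof.
case: n => [|[|[|n]]]; last exact: projective_zero.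
- exact/projective_dsum/projective_principal/projective_principal.
- exact/projective_dsum/projective_principal/projective_principal.
- exact: projective_principal.
Qed.

Lemma square_aug_epi : pepi square_aug.
Proof.
apply/pepiP => p [x y]; exists (const_mx (rowsum x), const_mx (rowsum y)).
by rewrite square_augE; congr pair; rewrite rowsum_widen ?rowsumK //;
  case: p {x y} => [[] []].
Qed.

Lemma square_aug_exact : pexact (square_diff 0) square_aug.
Proof.
apply/pexactP; split.
  apply: phom_ext => p x; rewrite pcompE square_diff0E square_augE phom0E.
  congr pair; apply: rowsum_inj; last by rewrite /= !rowsum0.
  case: p x => [[] []] [x y]; rewrite !rowsum_const /= ?rowsum0 //.
  rewrite rowsumD !(@rowsum_const _ true).
  by rewrite [rowsum x]rowsum_false [rowsum y]rowsum_false addr0.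
move=> p [x y]; rewrite square_augE => -[/(congr1 (@rowsum _ _)) x0 y0].
(* The vertex 11 is maximal, so P_11 = S_11 and the augmentation is injective on this summand. *)
have {y0}-> : y = 0.
  by apply: const_rowsum_eq0 y0; case: p {x y x0} => [[] []].
suff [u ux] : exists u : square_obj 1 p, rowsum x = rowsum u.1 + rowsum u.2.
  exists u; rewrite square_diff0E; congr pair; apply: rowsum_inj.
  by rewrite ux rowsumD !rowsum_widen //; case: p {x y x0 u ux} => [[] []].
(* At 11 and 10 a preimage is taken in P_10, at 01 in P_01; at 00 the augmentation sees the whole
   coordinate of [x], which therefore vanishes. *)
case: p x x0 {y} => [[] []] x x0.
- exists (const_mx (rowsum x), 0).
  by rewrite /= (@rowsum_const _ true) rowsum0 addr0.
- exists (const_mx (rowsum x), 0).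
  by rewrite /= (@rowsum_const _ true) rowsum0 addr0.
- exists (0, const_mx (rowsum x)).
  by rewrite /= (@rowsum_const _ true) rowsum0 add0r.
- exists (0, 0); move: x0; rewrite (@rowsum_const _ true) => ->.
  by rewrite !rowsum0 addr0.
Qed.

Lemma square_diff_exact n : pexact (square_diff n.+1) (square_diff n).
Proof.
case: n => [|[|n]]; apply/pexactP; split.
- apply: phom_ext => p x; rewrite pcompE square_diff1E square_diff0E phom0E.
  congr pair; apply: rowsum_inj; rewrite rowsumD rowsumN rowsum0.
  case: p x => [[] []] x; rewrite !rowsum_const /=.
  + exact: subrr.
  + by rewrite [rowsum x]rowsum_false; exact: subrr.
  + by rewrite [rowsum x]rowsum_false; exact: subrr.
  + exact: subrr.
(* The kernel condition reads x = -y. At 11 its solutions are the multiples of (1,-1), the image of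
   P_11; at the other vertices one of the two spaces is 0, so both coordinates vanish. *)
- move=> p [x y]; rewrite square_diff0E => -[/(congr1 (@rowsum _ _))].
  rewrite rowsumD rowsum0 !rowsum_widen; try by case: p {x y} => [[] []].
  move=> /eqP; rewrite addr_eq0 => /eqP xy.
  exists (const_mx (rowsum x)); rewrite square_diff1E.
  congr pair; apply: rowsum_inj; rewrite ?rowsumN; move: xy.
    case: p x y => [[] []] x y xy; rewrite !rowsum_const //=.
    + by rewrite xy [rowsum y]rowsum_false oppr0.
    + exact: rowsum_false.
    + exact: rowsum_false.
  case: p x y => [[] []] x y xy; rewrite !rowsum_const /= ?oppr0.
  + by rewrite xy opprK.
  + exact: rowsum_false.
  + by apply: oppr_inj; rewrite -xy [rowsum x]rowsum_false oppr0.
  + exact: rowsum_false.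
- exact: pcomp0r.
(* The first component P_11 -> P_10 is already injective. *)
- move=> p x; rewrite square_diff1E => -[x0 _]; exists 0.
  by rewrite linear0; apply: const_rowsum_eq0 x0; case: p {x} => [[] []].
- exact: pcomp0l.
- by move=> p x _; exists 0; rewrite linear0; exact: zero_pmodule_eq0.
Qed.

Definition square_resolution : proj_resolution M :=
  ProjResolution square_proj square_aug_epi square_aug_exact square_diff_exact.

(** The generators of P_10 and P_01 go to M_10 and M_01, which vanish because M is supported at 00
    and 11. *)
Lemma square_deg1_hom0 (f : phom (square_resolution 1) M) : f = 0.
Proof.
apply: dsum_hom_eq0; apply: principal_hom_eq; rewrite phom0E.
all: case: (pcomp _ _ _ _) => x y; congr pair; exact: thinmx0.
Qed.

End SquareResolution.

(** * Computation of Ext^2 on an arbitrary resolution *)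

Theorem proposition5p6 (k : fieldType) :
  let S00 : pmodule k square := simple k ((false, false) : square) in
  let S11 : pmodule k square := simple k ((true, true) : square) in
  let M : pmodule k square := dsum S00 S11 in
  inhabited (proj_resolution M) /\
  forall Q : proj_resolution M,
    (exists phi : {linear Ext Q 2 M -> k^o}, bijective phi) /\
    (exists c : Ext Q 2 M, c != 0).
Proof.
(* Inhabitation keeps the quantification over [Q] from being vacuous. The obstruction class is
   rendered as a nonzero element of [Ext Q 2 M]. *)
move=> S00 S11 M; split; first exact: (inhabits (square_resolution k)).
move=> Q; pose R := square_resolution k; pose v : square := (true, true).
have [F chF] := chain_map_exists R Q; have [G chG] := chain_map_exists Q R.
have [h hE] := chain_map_homotopy (chain_map_comp chG chF).
have [h' h'E] := chain_map_homotopy (chain_map_comp chF chG).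
have [_ FE] := chF; have [_ GE] := chG.
(* The projection [.2] selects the S_11 summand, the only nonzero part of M at 11. *)
pose pairing (f : phom (Q 2) M) : k^o :=
  rowsum (f v (F 2 v (principal_gen k v))).2.
have pairing0 f : pairing f = 0 -> pcomp f (F 2) = 0.
  move=> f0; apply: principal_hom_eq; rewrite pcompE phom0E.
  rewrite [LHS]surjective_pairing; congr pair; first exact: thinmx0.
  by apply: (@rowsum_inj _ true); rewrite [RHS]rowsum0.
pose L (f : cocycles Q 2 M) : k^o := pairing f.
have linL : linear L.
  by move=> a f g; rewrite /L /pairing phomDE phomZE; exact: rowsum_linear.
have eqL (f : cocycles Q 2 M) : (f \in @coboundary _ _ _ M Q 2 M) = (L f == 0).
  apply/asboolP/eqP => [[g fE]|/pairing0 fF0].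
    (* If f = g d, then f F_2 = g F_1 d, and g F_1 : R_1 -> M is 0. *)
    rewrite /L /pairing fE -(pcompE _ (F 2)) -pcompA FE pcompA.
    rewrite (square_deg1_hom0 (pcomp g (F 1))) pcomp0l phom0E.
    exact: rowsum0.
  (* Since f F_2 = 0, composing f with id - F_2 G_2 = d h_2 + h_1 d returns f on the left; on the
     right f d = 0, which leaves f = (f h_1) d. *)
  exists (pcomp f (h 1)); have /eqP f_cocycle := cocycleP f.
  rewrite -[LHS]pcomp1r -[pid _](subrK (pcomp (F 2) (G 2))) hE !pcompDr !pcompA.
  by rewrite f_cocycle fF0 !pcomp0l add0r addr0.
(* A cocycle of value 1: [i] sends the generator of P_11 to that of S_11, and G_2 carries it over to
   [Q]. *)
pose i : phom (R 2) M := pcomp (pinr _ _) (principal_top k v).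
pose c : phom (Q 2) M := pcomp i (G 2).
have c_cocycle : c \in @cocycle _ _ _ M Q 2 M.
  (* The differential R_3 -> R_2 is 0. *)
  by apply/eqP; rewrite -pcompA -GE pcomp0l pcomp0r.
have Lc : L (Cocycle c_cocycle) = 1.
  have iE : pcomp i (pcomp (G 2) (F 2)) = i.
    (* i (id - G_2 F_2) = i d h'_2 + i h'_1 d, where d : R_3 -> R_2 is 0 and i h'_1 : R_1 -> M is
       0. *)
    apply/eqP; rewrite eq_sym -subr_eq0 -{1}[i]pcomp1r -pcompBr h'E pcompDr.
    by rewrite !pcompA (square_deg1_hom0 (pcomp i (h' 1))) pcomp0l pcomp0r pcomp0l addr0.
  rewrite /L /pairing -(pcompE _ (F 2)) -pcompA iE pcompE pinrE principal_topE.
  by rewrite !(@rowsum_const _ true).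
pose Llin := HB.pack_for {linear cocycles Q 2 M -> k^o} L
  (GRing.isLinear.Build k _ k^o _ L linL).
have [phi phi_bij] := lquot_iso_field (L := Llin) eqL Lc.
split; first by exists phi.
have [psi phiK psiK] := phi_bij.
exists (psi 1); apply/eqP => psi0.
by have := psiK 1; rewrite psi0 linear0 => /esym/eqP; rewrite oner_eq0.
Qed.
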